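(* Let $\mathsf{K}$ be a positive universal class of pointed lattices, axiomatized by a set $\{\Phi_i : i\in I\}$ of sentences each of the form $\Phi = (t_1 \leq u_1 \text{ or } \dots \text{ or } t_k \leq u_k)$ (universally quantified, $t_j,u_j$ pointed lattice terms). For each such $\Phi$ let $\mathrm{Pre}(\Phi)$ be the RL equation $(\mathsf{1}\wedge (t_1\backslash u_1)) \vee \dots \vee (\mathsf{1}\wedge (t_k\backslash u_k)) \approx \mathsf{1}$. Then for every RL $\mathbf{A}$ the following are equivalent: (i) $\mathbf{A}$ satisfies $\mathrm{Pre}(\Phi_i)$ for all $i\in I$ (i.e. $\mathbf{A}$ is left pre-$\mathsf{K}$); (ii) every meet irreducible element of the lattice $\mathrm{Fi}_{\ast}\mathbf{A}$ is a left $\mathsf{K}$-filter; (ii') every completely meet irreducible element of $\mathrm{Fi}_{\ast}\mathbf{A}$ is a left $\mathsf{K}$-filter; (iii) ${\uparrow}\mathsf{1}$ is an intersection of left $\mathsf{K}$-filters of $\mathbf{A}$; (iv) every $F\in \mathrm{Fi}_{\ast}\mathbf{A}$ is an intersection of left $\mathsf{K}$-filters of $\mathbf{A}$.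
   Context: A pointed lattice is a lattice with a constant $\mathsf{1}$. A residuated lattice (RL) is an algebra $\langle A; \wedge, \vee, \cdot, \mathsf{1}, \backslash, / \rangle$ with a lattice reduct, a monoid reduct $\langle A;\cdot,\mathsf{1}\rangle$, and $x \leq z/y \iff x\cdot y \leq z \iff y \leq x\backslash z$. A multiplicative $\mathsf{1}$-filter of a RL $\mathbf{A}$ is a lattice filter $F$ containing $\mathsf{1}$ and closed under $\cdot$; $\mathrm{Fi}_{\ast}\mathbf{A}$ denotes the lattice of these ordered by inclusion. For such $F$, $\mathrm{L}\Theta(F)$ is the relation $\langle x,y\rangle\in \mathrm{L}\Theta(F) \iff x\backslash y\in F$ and $y\backslash x\in F$; it is a lattice congruence, and $\mathbf{A}/\mathrm{L}\Theta(F)$ denotes the resulting quotient pointed lattice (with constant the class of $\mathsf{1}$). $F$ is a left $\mathsf{K}$-filter if $\mathbf{A}/\mathrm{L}\Theta(F)\in\mathsf{K}$ as a pointed lattice. An intersection of an empty family of filters is the whole universe. *)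

(* Defs.v *)
From HB Require Import structures.
From mathcomp Require Import all_boot all_order.
From mathcomp Require Import boolp classical_sets.

Set Implicit Arguments.
Unset Strict Implicit.
Unset Printing Implicit Defensive.

Import Order.TTheory.
Local Open Scope order_scope.

(* The distinguished constant of a pointed lattice is [point]. *)
#[short(type="pointedLatticeType")]
HB.structure Definition PointedLattice (d : Order.disp_t) :=
  {L of Order.Lattice d L & isPointed L}.

(* [rdiv z y] is z / y and [ldiv x z] is x \ z. *)
HB.mixin Record isResiduated (d : Order.disp_t) A
    of Order.Lattice d A & monoid.Monoid A := {
  ldiv : A -> A -> A;
  rdiv : A -> A -> A;
  rdivP : forall x y z : A, (x <= rdiv z y) = ((x * y)%g <= z);
  ldivP : forall x y z : A, (y <= ldiv x z) = ((x * y)%g <= z);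
}.

#[short(type="residuatedLatticeType")]
HB.structure Definition ResiduatedLattice (d : Order.disp_t) :=
  {A of isResiduated d A & Order.Lattice d A & monoid.Monoid A}.

Inductive pl_term : Type :=
  | PVar of nat
  | POne
  | PMeet of pl_term & pl_term
  | PJoin of pl_term & pl_term.

Fixpoint pl_eval (d : Order.disp_t) (L : pointedLatticeType d) (v : nat -> L)
    (t : pl_term) : L :=
  match t with
  | PVar n => v n
  | POne => point
  | PMeet t1 t2 => pl_eval v t1 `&` pl_eval v t2
  | PJoin t1 t2 => pl_eval v t1 `|` pl_eval v t2
  end.

(* The universal sentence t_1 <= u_1 or ... or t_k <= u_k, with k >= 1: the
   pair (t_1, u_1), then the list of the pairs (t_2, u_2), ..., (t_k, u_k). *)
Record pl_clause : Type := PLClause {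
  clause_head : pl_term * pl_term;
  clause_tail : seq (pl_term * pl_term)
}.

Definition pl_satisfies (d : Order.disp_t) (L : pointedLatticeType d)
    (Phi : pl_clause) : Prop :=
  forall v : nat -> L,
    has (fun tu => pl_eval v tu.1 <= pl_eval v tu.2)
        (clause_head Phi :: clause_tail Phi).

Definition pl_class : Type :=
  forall d : Order.disp_t, pointedLatticeType d -> Prop.

Definition axiomatized_by (K : pl_class) (I : Type) (Phi : I -> pl_clause) :
    Prop :=
  forall (d : Order.disp_t) (L : pointedLatticeType d),
    K d L <-> forall i : I, pl_satisfies L (Phi i).

Inductive rl_term : Type :=
  | RVar of nat
  | ROne
  | RMeet of rl_term & rl_term
  | RJoin of rl_term & rl_term
  | RMul of rl_term & rl_term
  | RLdiv of rl_term & rl_term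
  | RRdiv of rl_term & rl_term.

Fixpoint rl_eval (d : Order.disp_t) (A : residuatedLatticeType d)
    (v : nat -> A) (t : rl_term) : A :=
  match t with
  | RVar n => v n
  | ROne => 1%g
  | RMeet t1 t2 => rl_eval v t1 `&` rl_eval v t2
  | RJoin t1 t2 => rl_eval v t1 `|` rl_eval v t2
  | RMul t1 t2 => (rl_eval v t1 * rl_eval v t2)%g
  | RLdiv t1 t2 => ldiv (rl_eval v t1) (rl_eval v t2)
  | RRdiv t1 t2 => rdiv (rl_eval v t1) (rl_eval v t2)
  end.

(* The pair (s, t) stands for the equation s = t. *)
Definition rl_equation : Type := (rl_term * rl_term)%type.

Definition rl_satisfies (d : Order.disp_t) (A : residuatedLatticeType d)
    (e : rl_equation) : Prop :=
  forall v : nat -> A, rl_eval v e.1 = rl_eval v e.2.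

Fixpoint rl_of_pl (t : pl_term) : rl_term :=
  match t with
  | PVar n => RVar n
  | POne => ROne
  | PMeet t1 t2 => RMeet (rl_of_pl t1) (rl_of_pl t2)
  | PJoin t1 t2 => RJoin (rl_of_pl t1) (rl_of_pl t2)
  end.

Definition Pre_disjunct (tu : pl_term * pl_term) : rl_term :=
  RMeet ROne (RLdiv (rl_of_pl tu.1) (rl_of_pl tu.2)).

Definition Pre (Phi : pl_clause) : rl_equation :=
  (foldl (fun s tu => RJoin s (Pre_disjunct tu))
         (Pre_disjunct (clause_head Phi)) (clause_tail Phi),
   ROne).

Record mulFilter (d : Order.disp_t) (A : residuatedLatticeType d) : Type :=
  MulFilter {
  mf_set :> set A;
  mf_one : mf_set 1%g;
  mf_up : forall x y : A, mf_set x -> x <= y -> mf_set y;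
  mf_meet : forall x y : A, mf_set x -> mf_set y -> mf_set (x `&` y);
  mf_mul : forall x y : A, mf_set x -> mf_set y -> mf_set (x * y)%g
}.

Lemma mulFilter_inj (d : Order.disp_t) (A : residuatedLatticeType d) :
  injective (@mf_set d A).
Proof.
case=> [F f1 f2 f3 f4] [G g1 g2 g3 g4] /= FG; subst G.
by congr MulFilter; exact: Prop_irrelevance.
Qed.

HB.instance Definition _ (d : Order.disp_t) (A : residuatedLatticeType d) :=
  gen_eqMixin (mulFilter A).
HB.instance Definition _ (d : Order.disp_t) (A : residuatedLatticeType d) :=
  gen_choiceMixin (mulFilter A).

Definition mulFilter_le (d : Order.disp_t) (A : residuatedLatticeType d)
    (F G : mulFilter A) : bool := `[< (F `<=` G)%classic >].

Lemma mulFilter_le_refl (d : Order.disp_t) (A : residuatedLatticeType d) :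
  reflexive (@mulFilter_le d A).
Proof. by move=> F; apply/asboolP. Qed.

Lemma mulFilter_le_anti (d : Order.disp_t) (A : residuatedLatticeType d) :
  antisymmetric (@mulFilter_le d A).
Proof.
move=> F G /andP[/asboolP FG /asboolP GF].
by apply: mulFilter_inj; apply/seteqP; split.
Qed.

Lemma mulFilter_le_trans (d : Order.disp_t) (A : residuatedLatticeType d) :
  transitive (@mulFilter_le d A).
Proof.
by move=> G F H /asboolP FG /asboolP GH; apply/asboolP => x /FG /GH.
Qed.

Fact mulFilter_display : Order.disp_t. Proof. exact: (Order.Disp tt tt). Qed.

HB.instance Definition _ (d : Order.disp_t) (A : residuatedLatticeType d) :=
  Order.Le_isPOrder.Build mulFilter_display (mulFilter A)
    (@mulFilter_le_refl d A) (@mulFilter_le_anti d A) (@mulFilter_le_trans d A).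

Definition mulFilter_bigcap (d : Order.disp_t) (A : residuatedLatticeType d)
    (S : set (mulFilter A)) : mulFilter A.
Proof.
apply: (@MulFilter d A (\bigcap_(F in S) (F : set A))%classic).
- by move=> F _; exact: mf_one.
- by move=> x y Sx xy F SF; exact: mf_up (Sx F SF) xy.
- by move=> x y Sx Sy F SF; apply: mf_meet; [exact: Sx|exact: Sy].
- by move=> x y Sx Sy F SF; apply: mf_mul; [exact: Sx|exact: Sy].
Defined.

Definition mulFilter_meet (d : Order.disp_t) (A : residuatedLatticeType d)
    (F G : mulFilter A) : mulFilter A.
Proof.
apply: (@MulFilter d A (F `&` G)%classic).
- by split; exact: mf_one.
- by move=> x y [Fx Gx] xy; split; [exact: mf_up Fx xy|exact: mf_up Gx xy].
- by move=> x y [Fx Gx] [Fy Gy]; split; apply: mf_meet.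
- by move=> x y [Fx Gx] [Fy Gy]; split; apply: mf_mul.
Defined.

Definition mulFilter_join (d : Order.disp_t) (A : residuatedLatticeType d)
    (F G : mulFilter A) : mulFilter A :=
  mulFilter_bigcap [set H : mulFilter A | F <= H /\ G <= H]%classic.

Lemma mulFilter_meetP (d : Order.disp_t) (A : residuatedLatticeType d)
    (F G H : mulFilter A) :
  (F <= mulFilter_meet G H) = (F <= G) && (F <= H).
Proof.
apply/asboolP/andP => [FGH|[/asboolP FG /asboolP FH] x Fx].
  by split; apply/asboolP => x /FGH[].
by split; [exact: FG|exact: FH].
Qed.

Lemma mulFilter_joinP (d : Order.disp_t) (A : residuatedLatticeType d)
    (F G H : mulFilter A) :
  (mulFilter_join F G <= H) = (F <= H) && (G <= H).
Proof.
apply/asboolP/andP => [FGH|[FH GH] x]; last by apply; split.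
by split; apply/asboolP => x Hx; apply: FGH => K [/asboolP FK /asboolP GK];
  auto.
Qed.

HB.instance Definition _ (d : Order.disp_t) (A : residuatedLatticeType d) :=
  Order.POrder_MeetJoin_isLattice.Build mulFilter_display (mulFilter A)
    (@mulFilter_meetP d A) (@mulFilter_joinP d A).

Definition meet_irreducible (d : Order.disp_t) (L : latticeType d) (x : L) :
    Prop :=
  forall y z : L, x = y `&` z -> x = y \/ x = z.

(* The top element, being the infimum of the empty set, is excluded. *)
Definition completely_meet_irreducible (d : Order.disp_t) (L : latticeType d)
    (x : L) : Prop :=
  forall S : set L, infimums S x -> S x.

Definition LTheta (d : Order.disp_t) (A : residuatedLatticeType d)
    (F : mulFilter A) : rel A :=
  fun x y => `[< mf_set F (ldiv x y) /\ mf_set F (ldiv y x) >].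

Lemma ldiv_mul_le (d : Order.disp_t) (A : residuatedLatticeType d) (x y : A) :
  (x * ldiv x y)%g <= y.
Proof. by rewrite -ldivP. Qed.

Lemma mulg_monol (d : Order.disp_t) (A : residuatedLatticeType d) (x y z : A) :
  x <= y -> (x * z)%g <= (y * z)%g.
Proof. by move=> xy; rewrite -rdivP (le_trans xy)// rdivP. Qed.

Lemma mulFilter_ldiv_le (d : Order.disp_t) (A : residuatedLatticeType d)
    (F : mulFilter A) (x y : A) : x <= y -> mf_set F (ldiv x y).
Proof. by move=> xy; apply: mf_up (mf_one F) _; rewrite ldivP mulg1. Qed.

Lemma mulFilter_ldiv_trans (d : Order.disp_t) (A : residuatedLatticeType d)
    (F : mulFilter A) (x y z : A) :
  mf_set F (ldiv x y) -> mf_set F (ldiv y z) -> mf_set F (ldiv x z).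
Proof.
move=> Fxy Fyz; apply: mf_up (mf_mul Fxy Fyz) _.
rewrite ldivP mulgA (le_trans (mulg_monol _ (ldiv_mul_le x y)))//.
exact: ldiv_mul_le.
Qed.

Lemma mulFilter_ldiv_meet (d : Order.disp_t) (A : residuatedLatticeType d)
    (F : mulFilter A) (x y z : A) :
  mf_set F (ldiv x y) -> mf_set F (ldiv x z) -> mf_set F (ldiv x (y `&` z)).
Proof.
move=> Fxy Fxz; apply: mf_up (mf_meet Fxy Fxz) _.
by rewrite ldivP lexI -!ldivP leIl leIr.
Qed.

Lemma mulFilter_ldiv_join (d : Order.disp_t) (A : residuatedLatticeType d)
    (F : mulFilter A) (x y z : A) :
  mf_set F (ldiv x z) -> mf_set F (ldiv y z) -> mf_set F (ldiv (x `|` y) z).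
Proof.
move=> Fxz Fyz; apply: mf_up (mf_meet Fxz Fyz) _.
by rewrite ldivP -rdivP leUx !rdivP -!ldivP leIl leIr.
Qed.

Lemma LTheta_refl (d : Order.disp_t) (A : residuatedLatticeType d)
    (F : mulFilter A) : reflexive (LTheta F).
Proof. by move=> x; apply/asboolP; split; exact: mulFilter_ldiv_le. Qed.

Lemma LTheta_sym (d : Order.disp_t) (A : residuatedLatticeType d)
    (F : mulFilter A) : symmetric (LTheta F).
Proof. by move=> x y; apply/asboolP/asboolP => -[]. Qed.

Lemma LTheta_trans (d : Order.disp_t) (A : residuatedLatticeType d)
    (F : mulFilter A) : transitive (LTheta F).
Proof.
move=> y x z /asboolP[xy yx] /asboolP[yz zy]; apply/asboolP.
by split; [exact: mulFilter_ldiv_trans xy yz|exact: mulFilter_ldiv_trans zy yx].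
Qed.

Canonical LTheta_equiv (d : Order.disp_t) (A : residuatedLatticeType d)
    (F : mulFilter A) : equiv_rel A :=
  EquivRel (LTheta F) (LTheta_refl F) (LTheta_sym F) (@LTheta_trans d A F).

Lemma LTheta_meet (d : Order.disp_t) (A : residuatedLatticeType d)
    (F : mulFilter A) (x x' y y' : A) :
  LTheta F x x' -> LTheta F y y' -> LTheta F (x `&` y) (x' `&` y').
Proof.
move=> /asboolP[xx' x'x] /asboolP[yy' y'y]; apply/asboolP; split.
  apply: mulFilter_ldiv_meet.
    by apply: mulFilter_ldiv_trans xx'; exact/mulFilter_ldiv_le/leIl.
  by apply: mulFilter_ldiv_trans yy'; exact/mulFilter_ldiv_le/leIr.
apply: mulFilter_ldiv_meet.
  by apply: mulFilter_ldiv_trans x'x; exact/mulFilter_ldiv_le/leIl.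
by apply: mulFilter_ldiv_trans y'y; exact/mulFilter_ldiv_le/leIr.
Qed.

Lemma LTheta_join (d : Order.disp_t) (A : residuatedLatticeType d)
    (F : mulFilter A) (x x' y y' : A) :
  LTheta F x x' -> LTheta F y y' -> LTheta F (x `|` y) (x' `|` y').
Proof.
move=> /asboolP[xx' x'x] /asboolP[yy' y'y]; apply/asboolP; split.
  apply: mulFilter_ldiv_join.
    by apply: mulFilter_ldiv_trans xx' _; exact/mulFilter_ldiv_le/leUl.
  by apply: mulFilter_ldiv_trans yy' _; exact/mulFilter_ldiv_le/leUr.
apply: mulFilter_ldiv_join.
  by apply: mulFilter_ldiv_trans x'x _; exact/mulFilter_ldiv_le/leUl.
by apply: mulFilter_ldiv_trans y'y _; exact/mulFilter_ldiv_le/leUr.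
Qed.

Definition quotPL (d : Order.disp_t) (A : residuatedLatticeType d)
    (F : mulFilter A) : Type := {eq_quot (LTheta F)}%qT.

HB.instance Definition _ (d : Order.disp_t) (A : residuatedLatticeType d)
    (F : mulFilter A) := Choice.on (quotPL F).
HB.instance Definition _ (d : Order.disp_t) (A : residuatedLatticeType d)
    (F : mulFilter A) := EqQuotient.on (quotPL F).

Definition quotPL_meet (d : Order.disp_t) (A : residuatedLatticeType d)
    (F : mulFilter A) (a b : quotPL F) : quotPL F :=
  \pi_(quotPL F)%qT (repr a `&` repr b).

Definition quotPL_join (d : Order.disp_t) (A : residuatedLatticeType d)
    (F : mulFilter A) (a b : quotPL F) : quotPL F :=
  \pi_(quotPL F)%qT (repr a `|` repr b).

Lemma quotPL_eqP (d : Order.disp_t) (A : residuatedLatticeType d)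
    (F : mulFilter A) (x y : A) :
  \pi_(quotPL F)%qT x = \pi_(quotPL F)%qT y <-> LTheta F x y.
Proof. by split => /eqmodP. Qed.

Lemma LTheta_repr (d : Order.disp_t) (A : residuatedLatticeType d)
    (F : mulFilter A) (x : A) : LTheta F (repr (\pi_(quotPL F)%qT x)) x.
Proof. by apply/quotPL_eqP; rewrite reprK. Qed.

Lemma quotPL_meetE (d : Order.disp_t) (A : residuatedLatticeType d)
    (F : mulFilter A) (x y : A) :
  quotPL_meet (\pi_(quotPL F)%qT x) (\pi_(quotPL F)%qT y)
  = \pi_(quotPL F)%qT (x `&` y).
Proof. by apply/quotPL_eqP/LTheta_meet; exact: LTheta_repr. Qed.

Lemma quotPL_joinE (d : Order.disp_t) (A : residuatedLatticeType d)
    (F : mulFilter A) (x y : A) :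
  quotPL_join (\pi_(quotPL F)%qT x) (\pi_(quotPL F)%qT y)
  = \pi_(quotPL F)%qT (x `|` y).
Proof. by apply/quotPL_eqP/LTheta_join; exact: LTheta_repr. Qed.

Lemma quotPL_meetC (d : Order.disp_t) (A : residuatedLatticeType d)
    (F : mulFilter A) : commutative (@quotPL_meet d A F).
Proof. by move=> a b; rewrite /quotPL_meet meetC. Qed.

Lemma quotPL_joinC (d : Order.disp_t) (A : residuatedLatticeType d)
    (F : mulFilter A) : commutative (@quotPL_join d A F).
Proof. by move=> a b; rewrite /quotPL_join joinC. Qed.

Lemma quotPL_meetA (d : Order.disp_t) (A : residuatedLatticeType d)
    (F : mulFilter A) : associative (@quotPL_meet d A F).
Proof.
elim/quotW=> x; elim/quotW=> y; elim/quotW=> z.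
by rewrite (quotPL_meetE F y z) (quotPL_meetE F x y) !quotPL_meetE meetA.
Qed.

Lemma quotPL_joinA (d : Order.disp_t) (A : residuatedLatticeType d)
    (F : mulFilter A) : associative (@quotPL_join d A F).
Proof.
elim/quotW=> x; elim/quotW=> y; elim/quotW=> z.
by rewrite (quotPL_joinE F y z) (quotPL_joinE F x y) !quotPL_joinE joinA.
Qed.

Lemma quotPL_joinKI (d : Order.disp_t) (A : residuatedLatticeType d)
    (F : mulFilter A) (b a : quotPL F) : quotPL_meet a (quotPL_join a b) = a.
Proof.
elim/quotW: a => x; elim/quotW: b => y.
by rewrite (quotPL_joinE F x y) quotPL_meetE joinKI.
Qed.

Lemma quotPL_meetKU (d : Order.disp_t) (A : residuatedLatticeType d)
    (F : mulFilter A) (b a : quotPL F) : quotPL_join a (quotPL_meet a b) = a.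
Proof.
elim/quotW: a => x; elim/quotW: b => y.
by rewrite (quotPL_meetE F x y) quotPL_joinE meetKU.
Qed.

Definition quotPL_le (d : Order.disp_t) (A : residuatedLatticeType d)
    (F : mulFilter A) (a b : quotPL F) : bool := quotPL_meet a b == a.

Lemma quotPL_le_refl (d : Order.disp_t) (A : residuatedLatticeType d)
    (F : mulFilter A) : reflexive (@quotPL_le d A F).
Proof. by elim/quotW=> x; rewrite /quotPL_le quotPL_meetE meetxx. Qed.

Lemma quotPL_le_anti (d : Order.disp_t) (A : residuatedLatticeType d)
    (F : mulFilter A) : antisymmetric (@quotPL_le d A F).
Proof.
by move=> a b /andP[/eqP ab /eqP ba]; rewrite -ab quotPL_meetC ba.
Qed.

Lemma quotPL_le_trans (d : Order.disp_t) (A : residuatedLatticeType d)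
    (F : mulFilter A) : transitive (@quotPL_le d A F).
Proof.
move=> b a c /eqP ab /eqP bc; apply/eqP.
by rewrite -ab -quotPL_meetA bc.
Qed.

HB.instance Definition _ (d : Order.disp_t) (A : residuatedLatticeType d)
    (F : mulFilter A) :=
  Order.Le_isPOrder.Build d (quotPL F) (@quotPL_le_refl d A F)
    (@quotPL_le_anti d A F) (@quotPL_le_trans d A F).
HB.instance Definition _ (d : Order.disp_t) (A : residuatedLatticeType d)
    (F : mulFilter A) :=
  Order.POrder_isLattice.Build d (quotPL F) (@quotPL_meetC d A F)
    (@quotPL_joinC d A F) (@quotPL_meetA d A F) (@quotPL_joinA d A F)
    (@quotPL_joinKI d A F) (@quotPL_meetKU d A F) (fun a b => erefl).
HB.instance Definition _ (d : Order.disp_t) (A : residuatedLatticeType d)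
    (F : mulFilter A) :=
  isPointed.Build (quotPL F) (\pi_(quotPL F)%qT 1%g).

Definition left_K_filter (K : pl_class) (d : Order.disp_t)
    (A : residuatedLatticeType d) (F : mulFilter A) : Prop :=
  K d (quotPL F).

(* The intersection of the empty family is the whole universe of A. *)
Definition inter_of_left_K_filters (K : pl_class) (d : Order.disp_t)
    (A : residuatedLatticeType d) (X : set A) : Prop :=
  exists S : set (mulFilter A),
    (forall F : mulFilter A, S F -> left_K_filter K F) /\
    X = (\bigcap_(F in S) (F : set A))%classic.

(* Main.v *)
Require Import Defs.
From mathcomp Require Import all_boot all_order.
From mathcomp Require Import boolp classical_sets.

(** Adjoining to [F] an element [a <= 1] gives the filter of all [x] above some
    [(f a)^n] with [f <= 1] in [F].  If [c, d <= 1], every word of length [n + m]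
    in [c, d] has [n] letters [c] or [m] letters [d], so that
    [(c \/ d)^(n+m) <= c^n \/ d^m]; hence [a \/ b \in F] makes [F] the
    intersection of its extensions by [a] and by [b], and a meet irreducible [F]
    is prime for joins of elements below [1].  Since
    [t <= u] holds in [A/LTheta(F)] exactly when [t \ u] is in [F], this primeness
    turns the equation [Pre Phi] of [A] into the clause [Phi] of the quotient.
    Zorn's lemma makes every filter an intersection of completely meet
    irreducible ones.  Conversely, if the quotients by the filters of a family
    satisfy [Phi], the join in [Pre Phi] lies in all these filters, so it is
    above [1] when they intersect in the principal filter of [1]. *)

Set Implicit Arguments.
Unset Strict Implicit.
Unset Printing Implicit Defensive.

Import Order.TTheory.
Local Open Scope classical_set_scope.
Local Open Scope order_scope.

(** * Powers in residuated lattices *)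

Lemma mulg_monor (d : Order.disp_t) (A : residuatedLatticeType d) (x y z : A) :
  x <= y -> (z * x)%g <= (z * y)%g.
Proof. by move=> xy; rewrite -ldivP (le_trans xy)// ldivP. Qed.

Lemma mulg_mono (d : Order.disp_t) (A : residuatedLatticeType d)
    (x y z t : A) : x <= y -> z <= t -> (x * z)%g <= (y * t)%g.
Proof. by move=> xy zt; exact: le_trans (mulg_monol _ xy) (mulg_monor _ zt). Qed.

Lemma mulg_joinr (d : Order.disp_t) (A : residuatedLatticeType d)
    (x y z : A) : (x * (y `|` z))%g <= (x * y)%g `|` (x * z)%g.
Proof. by rewrite -ldivP leUx !ldivP leUl leUr. Qed.

Lemma expg_mono (d : Order.disp_t) (A : residuatedLatticeType d)
    (x y : A) (n : nat) : x <= y -> (x ^+ n)%g <= (y ^+ n)%g.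
Proof. by move=> xy; elim: n => // n IHn; rewrite !expgS mulg_mono. Qed.

Lemma expg_le1 (d : Order.disp_t) (A : residuatedLatticeType d)
    (x : A) (n : nat) : x <= 1%g -> (x ^+ n)%g <= 1%g.
Proof. by move=> /(expg_mono n); rewrite expg1n. Qed.

Lemma mulg_le1l (d : Order.disp_t) (A : residuatedLatticeType d) (x y : A) :
  x <= 1%g -> (x * y)%g <= y.
Proof. by move=> /(mulg_monol y); rewrite mul1g. Qed.

Lemma mulg_le1r (d : Order.disp_t) (A : residuatedLatticeType d) (x y : A) :
  y <= 1%g -> (x * y)%g <= x.
Proof. by move=> /(mulg_monor x); rewrite mulg1. Qed.

(** Induction on [n + m] with [x] arbitrary: splitting off a leading factor [c] turns the target
    into [ldiv c x], which is above the power of [c] with one factor fewer and, because [c <= 1],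
    still above the power of [e]. A leading [e] is symmetric. *)
Lemma expg_join_le (d : Order.disp_t) (A : residuatedLatticeType d)
    (c e x : A) (n m : nat) :
  c <= 1%g -> e <= 1%g -> (c ^+ n)%g <= x -> (e ^+ m)%g <= x ->
  ((c `|` e) ^+ (n + m))%g <= x.
Proof.
move=> c1 e1; have ce1 : c `|` e <= 1%g by rewrite leUx c1.
have [k] := ubnP (n + m); elim: k n m x => // k IHk [|n] [|m] x.
- by rewrite expg0.
- by move=> _ /(le_trans (expg_le1 _ ce1)).
- by move=> _ _ /(le_trans (expg_le1 _ ce1)).
rewrite addSn ltnS => nmk cx ex.
rewrite expgS -rdivP leUx !rdivP -!ldivP; apply/andP; split.
  by apply: IHk => //; rewrite ldivP -?expgS// (le_trans (mulg_le1l _ c1)).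
rewrite -addSnnS; apply: IHk; rewrite ?addSnnS// ldivP -?expgS//.
by rewrite (le_trans (mulg_le1l _ e1)).
Qed.

(** * Prime and irreducible filters *)

Lemma mulFilter_expg (d : Order.disp_t) (A : residuatedLatticeType d)
    (F : mulFilter A) (x : A) (n : nat) : mf_set F x -> mf_set F (x ^+ n)%g.
Proof.
move=> Fx; elim: n => [|n IHn]; first exact: mf_one.
by rewrite expgS; exact: mf_mul.
Qed.

(** Factors from [F] and copies of [a] interleave, as multiplication need not commute. The meet of 1
    with all factors from [F] is a single [f] below each of them, so powers of [f * a] suffice. *)
Definition adjoin_set (d : Order.disp_t) (A : residuatedLatticeType d)
    (F : mulFilter A) (a : A) : set A :=
  [set x | exists f n, [/\ mf_set F f, f <= 1%g & ((f * a) ^+ n)%g <= x]].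

Lemma adjoin_mul (d : Order.disp_t) (A : residuatedLatticeType d)
    (F : mulFilter A) (a x y : A) :
  adjoin_set F a x -> adjoin_set F a y -> adjoin_set F a (x * y)%g.
Proof.
move=> [f [n [Ff f1 fx]]] [g [m [Fg g1 gy]]].
exists (f `&` g), (n + m); split; [exact: mf_meet|exact: leIxl|].
rewrite expgnDr mulg_mono//.
  by apply: le_trans fx; apply/expg_mono/mulg_monol/leIl.
by apply: le_trans gy; apply/expg_mono/mulg_monol/leIr.
Qed.

Lemma adjoin_meet (d : Order.disp_t) (A : residuatedLatticeType d)
    (F : mulFilter A) (a x y : A) : a <= 1%g ->
  adjoin_set F a x -> adjoin_set F a y -> adjoin_set F a (x `&` y).
Proof.
move=> a1 [f [n [Ff f1 fx]]] [g [m [Fg g1 gy]]].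
have fa1 : ((f `&` g) * a)%g <= 1%g.
  by rewrite (le_trans (mulg_le1r _ a1))// leIxl.
exists (f `&` g), (n + m); split; [exact: mf_meet|exact: leIxl|].
(* The power [n + m] is below both shorter powers because the surplus factors are at most 1. *)
rewrite expgnDr lexI; apply/andP; split.
  apply: le_trans (mulg_le1r _ (expg_le1 _ fa1)) (le_trans _ fx).
  exact/expg_mono/mulg_monol/leIl.
apply: le_trans (mulg_le1l _ (expg_le1 _ fa1)) (le_trans _ gy).
exact/expg_mono/mulg_monol/leIr.
Qed.

Definition adjoin (d : Order.disp_t) (A : residuatedLatticeType d)
    (F : mulFilter A) (a : A) (a1 : a <= 1%g) : mulFilter A.
Proof.
apply: (@MulFilter d A (adjoin_set F a)).
- by exists 1%g, 0; split => //; exact: mf_one.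
- move=> x y [f [n [Ff f1 fx]]] xy.
  by exists f, n; split => //; exact: le_trans xy.
- by move=> x y; exact: adjoin_meet.
- by move=> x y; exact: adjoin_mul.
Defined.

Lemma adjoin_sub (d : Order.disp_t) (A : residuatedLatticeType d)
    (F : mulFilter A) (a : A) (a1 : a <= 1%g) : F `<=` adjoin F a1.
Proof.
(* [x] need not be below 1, so its meet with 1 is the multiplier. *)
move=> x Fx; exists (x `&` 1%g), 1; split; [|exact: leIr|].
  exact/mf_meet/mf_one.
by rewrite expg1 (le_trans (mulg_le1r _ a1))// leIl.
Qed.

Lemma adjoin_mem (d : Order.disp_t) (A : residuatedLatticeType d)
    (F : mulFilter A) (a : A) (a1 : a <= 1%g) : mf_set (adjoin F a1) a.
Proof. by exists 1%g, 1; split; [exact: mf_one| |rewrite expg1 mul1g]. Qed.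

Lemma adjoin_meetE (d : Order.disp_t) (A : residuatedLatticeType d)
    (F : mulFilter A) (a b : A) (a1 : a <= 1%g) (b1 : b <= 1%g) :
  mf_set F (a `|` b) -> F = adjoin F a1 `&` adjoin F b1.
Proof.
move=> Fab; apply: mulFilter_inj; apply/seteqP; split => x.
  by move=> Fx; split; exact: adjoin_sub.
move=> [[f [n [Ff f1 fx]]] [g [m [Fg g1 gx]]]].
(* A multiplier common to both powers can be factored out: [h] times the join of [a] and [b] is in
   [F] and below the join of [h * a] and [h * b]. *)
pose h := f `&` g.
have Fh : mf_set F h by exact: mf_meet.
have h1 : h <= 1%g by exact: leIxl.
have hc (c : A) : c <= 1%g -> (h * c)%g <= 1%g.
  by move=> c1; rewrite (le_trans (mulg_le1r _ c1)).
have hx : (((h * a) `|` (h * b)) ^+ (n + m))%g <= x.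
  apply: expg_join_le; rewrite ?hc//.
    by apply: le_trans fx; apply/expg_mono/mulg_monol/leIl.
  by apply: le_trans gx; apply/expg_mono/mulg_monol/leIr.
apply: mf_up hx; apply: mulFilter_expg.
by apply: mf_up (mulg_joinr h a b); exact: mf_mul.
Qed.

Lemma meet_irreducible_prime (d : Order.disp_t) (A : residuatedLatticeType d)
    (F : mulFilter A) (a b : A) : meet_irreducible F ->
  a <= 1%g -> b <= 1%g -> mf_set F (a `|` b) -> mf_set F a \/ mf_set F b.
Proof.
move=> irrF a1 b1 /(adjoin_meetE a1 b1)/irrF[] ->;
  [left|right]; exact: adjoin_mem.
Qed.

Lemma completely_meet_irreducible_meet (d : Order.disp_t) (L : latticeType d)
    (x : L) : completely_meet_irreducible x -> meet_irreducible x.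
Proof.
(* A binary meet is the infimum of a pair. *)
move=> irrx y z xyz; suff [] : [set y; z] x by [left|right].
apply: irrx; split=> [w [->|->]|w lbw]; rewrite xyz ?leIl ?leIr//.
by rewrite lexI !lbw//; [right|left].
Qed.

(** * Separation by completely meet irreducible filters *)

Lemma mulFilter_leP (d : Order.disp_t) (A : residuatedLatticeType d)
    (F G : mulFilter A) : reflect (F `<=` G) (F <= G).
Proof. exact: asboolP. Qed.

(** Some member supplies 1; totality puts any two elements of the union in a common member, which is
    closed under meet and product. *)
Lemma mulFilter_chain_union (d : Order.disp_t) (A : residuatedLatticeType d)
    (C : set (mulFilter A)) : C !=set0 -> total_on C <=%O ->
  exists G : mulFilter A, G = \bigcup_(F in C) F :> set A.
Proof.
move=> [F0 CF0] totC; pose U := \bigcup_(F in C) (F : set A).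
have dirU x y : U x -> U y -> exists2 F, C F & mf_set F x /\ mf_set F y.
  move=> [F CF Fx] [G CG Gy].
  have [/mulFilter_leP FG|/mulFilter_leP GF] := totC _ _ CF CG.
    by exists G => //; split => //; exact: FG.
  by exists F => //; split => //; exact: GF.
have U1 : U 1%g by exists F0 => //; exact: mf_one.
have Uup x y : U x -> x <= y -> U y.
  by move=> [F CF Fx] xy; exists F => //; exact: mf_up xy.
have Umeet x y : U x -> U y -> U (x `&` y)%O.
  by move=> Ux /(dirU _ _ Ux)[F CF []]; exists F => //; exact: mf_meet.
have Umul x y : U x -> U y -> U (x * y)%g.
  by move=> Ux /(dirU _ _ Ux)[F CF []]; exists F => //; exact: mf_mul.
by exists (MulFilter U1 Uup Umeet Umul).
Qed.

Lemma mulFilter_maximal_avoiding (d : Order.disp_t)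
    (A : residuatedLatticeType d) (F : mulFilter A) (x : A) : ~ mf_set F x ->
  exists G : mulFilter A,
    [/\ F <= G, ~ mf_set G x &
        forall H : mulFilter A, G <= H -> ~ mf_set H x -> H = G].
Proof.
move=> nFx; pose T := {G : mulFilter A | F <= G /\ ~ mf_set G x}.
pose R (G H : T) := sval G <= sval H.
have [|||C totC|[G [FG nGx]] maxG] := @Zorn T R.
- by move=> G; exact: lexx.
- by move=> G H K; exact: le_trans.
- by move=> [G GP] [H HP] GH HG; apply/eq_exist/le_anti; rewrite [_ <= _]GH.
(* The empty chain has no filter as its union; [F] bounds it. *)
- have [[G CG]|C0] := pselect (C !=set0); last first.
    have FF : F <= F /\ ~ mf_set F x by [].
    by exists (exist _ F FF) => G CG; exfalso; apply: C0; exists G.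
  have [||U UE] := @mulFilter_chain_union _ _ [set sval G | G in C].
  + by exists (sval G), G.
  + by move=> _ _ [H CH <-] [K CK <-]; exact: totC.
  have CU (H : T) : C H -> sval H <= U.
    move=> CH; apply/mulFilter_leP => y Hy.
    by rewrite UE; exists (sval H) => //; exists H.
  have UP : F <= U /\ ~ mf_set U x.
    split; first exact: le_trans (svalP G).1 (CU _ CG).
    by rewrite UE => -[_ [H _ <-]]; exact: (svalP H).2.
  by exists (exist _ U UP).
exists G; split => // H GH nHx.
have HP : F <= H /\ ~ mf_set H x by split => //; exact: le_trans GH.
by have /(congr1 sval) := maxG (exist _ H HP) GH.
Qed.

(** Take [G] maximal among the filters above [F] that omit [x]. If [G] were the infimum of a family
    without being a member, every member would be strictly above [G] and contain [x]; then so would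
    their intersection, which is below [G]. *)
Lemma mulFilter_separation (d : Order.disp_t) (A : residuatedLatticeType d)
    (F : mulFilter A) (x : A) : ~ mf_set F x ->
  exists G : mulFilter A,
    [/\ F <= G, ~ mf_set G x & completely_meet_irreducible G].
Proof.
move=> /mulFilter_maximal_avoiding[G [FG nGx maxG]]; exists G; split => //.
move=> S [lbG glbG]; apply: contrapT => nSG; apply: nGx.
have /mulFilter_leP : mulFilter_bigcap S <= G.
  by apply: glbG => H SH; apply/mulFilter_leP => y; exact.
apply=> H SH; apply: contrapT => nHx; apply: nSG.
by rewrite -(maxG H (lbG _ SH) nHx).
Qed.

(** * Clauses in the quotients *)

(** The order of the quotient identifies [x] with its meet with [y]. One of the two memberships
    required is automatic; the other amounts to [ldiv x y] being in [F]. *)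
Lemma quotPL_leE (d : Order.disp_t) (A : residuatedLatticeType d)
    (F : mulFilter A) (x y : A) :
  (\pi_(quotPL F)%qT x <= \pi_(quotPL F)%qT y) = `[< mf_set F (ldiv x y) >].
Proof.
rewrite [LHS]/(quotPL_le _ _) /quotPL_le quotPL_meetE.
apply/eqP/asboolP => [/quotPL_eqP/asboolP[_ Fxy]|Fxy].
  by apply: mulFilter_ldiv_trans Fxy _; exact/mulFilter_ldiv_le/leIr.
apply/quotPL_eqP/asboolP; split; first exact/mulFilter_ldiv_le/leIl.
by apply: mulFilter_ldiv_meet => //; exact: mulFilter_ldiv_le.
Qed.

Lemma pl_eval_quotPL (d : Order.disp_t) (A : residuatedLatticeType d)
    (F : mulFilter A) (v : nat -> A) (t : pl_term) :
  pl_eval (fun n => \pi_(quotPL F)%qT (v n)) t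
  = \pi_(quotPL F)%qT (rl_eval v (rl_of_pl t)).
Proof.
elim: t => //= t IHt u IHu; rewrite IHt IHu; first exact: quotPL_meetE.
exact: quotPL_joinE.
Qed.

Definition ldiv_mem (d : Order.disp_t) (A : residuatedLatticeType d)
    (F : mulFilter A) (v : nat -> A) (tu : pl_term * pl_term) : bool :=
  `[< mf_set F (ldiv (rl_eval v (rl_of_pl tu.1))
                     (rl_eval v (rl_of_pl tu.2))) >].

Lemma quotPL_satisfiesP (d : Order.disp_t) (A : residuatedLatticeType d)
    (F : mulFilter A) (Phi : pl_clause) :
  pl_satisfies (quotPL F) Phi <->
  forall v : nat -> A,
    has (ldiv_mem F v) (clause_head Phi :: clause_tail Phi).
Proof.
split=> [satF v|satF v].
  have := satF (fun n => \pi_(quotPL F)%qT (v n)).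
  by under eq_has do rewrite !pl_eval_quotPL quotPL_leE.
(* Every valuation in the quotient lifts to [A] through representatives. *)
have -> : v = fun n => \pi_(quotPL F)%qT (repr (v n)).
  by apply/funext => n; rewrite reprK.
under eq_has do rewrite !pl_eval_quotPL quotPL_leE.
exact: satF.
Qed.

(** * The equation [Pre Phi] and filter membership *)

Lemma Pre_disjunctP (d : Order.disp_t) (A : residuatedLatticeType d)
    (F : mulFilter A) (v : nat -> A) (tu : pl_term * pl_term) :
  reflect (mf_set F (rl_eval v (Pre_disjunct tu))) (ldiv_mem F v tu).
Proof.
apply: (iffP (asboolP _)) => /= Ftu; first exact/mf_meet/Ftu/mf_one.
by apply: mf_up Ftu _; exact: leIr.
Qed.

Lemma Pre_disjunct_le1 (d : Order.disp_t) (A : residuatedLatticeType d)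
    (v : nat -> A) (tu : pl_term * pl_term) :
  rl_eval v (Pre_disjunct tu) <= 1%g.
Proof. exact: leIl. Qed.

Lemma Pre_le1 (d : Order.disp_t) (A : residuatedLatticeType d)
    (v : nat -> A) (Phi : pl_clause) : rl_eval v (Pre Phi).1 <= 1%g.
Proof.
case: Phi => tu l /=; have := Pre_disjunct_le1 v tu.
(* The [foldl] accumulates the join from the left, so the induction on the tail generalizes the head
   to an arbitrary term [s]. *)
elim: l (Pre_disjunct tu) => //= tu' l IHl s s1.
by apply: IHl; rewrite /= leUx s1 Pre_disjunct_le1.
Qed.

Lemma mulFilter_Pre (d : Order.disp_t) (A : residuatedLatticeType d)
    (F : mulFilter A) (v : nat -> A) (Phi : pl_clause) :
  has (ldiv_mem F v) (clause_head Phi :: clause_tail Phi) ->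
  mf_set F (rl_eval v (Pre Phi).1).
Proof.
case: Phi => tu l /= /orP; rewrite -(rwP (Pre_disjunctP F v tu)).
elim: l (Pre_disjunct tu) => [|tu' l IHl] s /=; first by case.
move=> Fs; apply: IHl; case: Fs => [Fs|/orP[/Pre_disjunctP Ftu'|]];
  last by right.
  by left; apply: mf_up Fs _; exact: leUl.
by left; apply: mf_up Ftu' _; exact: leUr.
Qed.

Lemma meet_irreducible_Pre (d : Order.disp_t) (A : residuatedLatticeType d)
    (F : mulFilter A) (v : nat -> A) (Phi : pl_clause) : meet_irreducible F ->
  mf_set F (rl_eval v (Pre Phi).1) ->
  has (ldiv_mem F v) (clause_head Phi :: clause_tail Phi).
Proof.
move=> irrF; case: Phi => tu l /= Fl.
apply/orP; rewrite -(rwP (Pre_disjunctP F v tu)).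
(* The bound by 1 is carried through the induction, since primeness is available only for joins of
   elements below 1. *)
have := Pre_disjunct_le1 v tu.
elim: l (Pre_disjunct tu) Fl => [|tu' l IHl] s /= Fl s1; first by left.
have [|Fstu'|->] := IHl _ Fl; last by right; rewrite orbT.
  by rewrite /= leUx s1 Pre_disjunct_le1.
have [|Fs|/Pre_disjunctP ->] := meet_irreducible_prime irrF s1 _ Fstu'.
- exact: Pre_disjunct_le1.
- by left.
- by right.
Qed.

Theorem theorem3p26 (K : pl_class) (I : Type) (Phi : I -> pl_clause)
    (HK : axiomatized_by K Phi)
    (d : Order.disp_t) (A : residuatedLatticeType d) :
  [<-> (* (i) *)
       forall i : I, rl_satisfies A (Pre (Phi i));
       (* (ii) *)
       forall F : mulFilter A, meet_irreducible F -> left_K_filter K F;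
       (* (ii') *)
       forall F : mulFilter A,
         completely_meet_irreducible F -> left_K_filter K F;
       (* (iii) *)
       inter_of_left_K_filters K [set x : A | (1%g <= x)%O]%classic;
       (* (iv) *)
       forall F : mulFilter A, inter_of_left_K_filters K (F : set A)].
Proof.
have LK (F : mulFilter A) : left_K_filter K F <-> forall (i : I) (v : nat -> A),
    has (ldiv_mem F v) (clause_head (Phi i) :: clause_tail (Phi i)).
  rewrite /left_K_filter HK.
  by split=> satF i; apply/quotPL_satisfiesP; exact: satF.
have i_ii : (forall i, rl_satisfies A (Pre (Phi i))) ->
    forall F : mulFilter A, meet_irreducible F -> left_K_filter K F.
  move=> preA F irrF; apply/LK => i v; apply: meet_irreducible_Pre => //.
  by rewrite preA; exact: mf_one.
have ii_ii' : (forall F : mulFilter A, meet_irreducible F ->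
      left_K_filter K F) ->
    forall F : mulFilter A, completely_meet_irreducible F -> left_K_filter K F.
  by move=> irrK F /completely_meet_irreducible_meet/irrK.
have ii'_iv : (forall F : mulFilter A, completely_meet_irreducible F ->
      left_K_filter K F) ->
    forall F : mulFilter A, inter_of_left_K_filters K (F : set A).
  move=> irrK F.
  exists [set G : mulFilter A | F <= G /\ completely_meet_irreducible G].
  split=> [G [_ /irrK]//|]; apply/seteqP; split=> x.
    by move=> Fx G [/mulFilter_leP FG _]; exact: FG.
  move=> Sx; apply: contrapT => /mulFilter_separation[G [FG nGx irrG]].
  by apply: nGx; exact: Sx.
have iv_iii : (forall F : mulFilter A, inter_of_left_K_filters K (F : set A)) ->
    inter_of_left_K_filters K [set x : A | 1%g <= x].
  (* (iii) is the instance of (iv) at the principal filter of 1. *)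
  have up1up (x y : A) : 1%g <= x -> x <= y -> 1%g <= y by exact: le_trans.
  have up1I (x y : A) : 1%g <= x -> 1%g <= y -> 1%g <= x `&` y.
    by move=> x1 y1; rewrite lexI x1.
  have up1M (x y : A) : 1%g <= x -> 1%g <= y -> 1%g <= (x * y)%g.
    by move=> x1 y1; rewrite -[1%g]mulg1 mulg_mono.
  exact: (fun interK =>
    interK (@MulFilter d A [set x | 1%g <= x] (lexx _) up1up up1I up1M)).
have iii_i : inter_of_left_K_filters K [set x : A | 1%g <= x] ->
    forall i, rl_satisfies A (Pre (Phi i)).
  move=> [S [SK up1E]] i v; apply: le_anti; rewrite Pre_le1 /=.
  suff : [set x : A | 1%g <= x] (rl_eval v (Pre (Phi i)).1) by [].
  by rewrite up1E => F /SK/LK FK; exact: mulFilter_Pre.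
(* The implications proved form the cycle (i), (ii), (ii'), (iv), (iii), (i); those demanded in the
   listed order are compositions along it. *)
tfae.
- exact: i_ii.
- exact: ii_ii'.
- by move=> /ii'_iv/iv_iii.
- by move=> /iii_i/i_ii/ii_ii'/ii'_iv.
- by move=> /iv_iii/iii_i.
Qed.
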